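(* Let $\alpha\in(0,1)$, $\kappa>0$, $T>0$, $N\in\mathbb{N}$, $\tau=T/N$, and let $\Omega\subset\mathbb{R}^d$, $d\in\{1,2,3\}$, be a bounded smooth domain. Suppose $u_0\in H_0^1(\Omega)$ and let $u_1,\dots,u_N$ be the solution of the convex splitting (CS) scheme $$\bar\partial_\tau^\alpha u_n-\kappa^2\Delta u_n=u_{n-1}-(u_n)^3\ \text{ in }\Omega,\qquad u_n=0\ \text{ on }\partial\Omega,\qquad 1\le n\le N.$$ Then the scheme satisfies the energy stability $$E(u_n)\le E(u_0)\qquad\text{for all } n\ge1,$$ where $E(u)=\int_\Omega\frac{\kappa^2}{2}|\nabla u(x)|^2+\frac14(1-u(x)^2)^2\,dx$.
   Context: The backward Euler convolution quadrature is $\bar\partial_\tau^\alpha u_n=\tau^{-\alpha}\sum_{j=1}^n\omega_{n-j}(u_j-u_0)$, with $\omega_0=1$ and $\omega_j=(-1)^j\frac{\alpha(\alpha-1)\cdots(\alpha-j+1)}{j!}$ for $j\ge1$. The scheme is discrete in time and continuous in space; at each step it is a uniquely solvable nonlinear elliptic problem for $u_n\in H_0^1(\Omega)$, given $u_0,\dots,u_{n-1}$. *)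

(* Defs.v *)
From HB Require Import structures.
From mathcomp Require Import all_boot all_order all_algebra.
From mathcomp Require Import all_classical all_reals all_analysis.

Set Implicit Arguments.
Unset Strict Implicit.
Unset Printing Implicit Defensive.

Import Order.TTheory GRing.Theory Num.Theory.
Import numFieldNormedType.Exports.

Local Open Scope classical_set_scope.
Local Open Scope ring_scope.

(* The product sigma-algebra on row vectors, i.e. the one generated by the
   coordinates; for T = R it is the Borel sigma-algebra of R^n. *)

Definition measure_rV_display : measure_display -> measure_display.
Proof. exact. Qed.

Section measurable_rV.
Context {d : measure_display} {T : sigmaRingType d}.
Variable n : nat.

Let coors : 'I_n -> 'rV[T]_n -> T := fun i x => x ord0 i.

Let rV_set0 : g_sigma_preimage coors set0.
Proof. exact: sigma_algebra0. Qed.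

Let rV_setC A : g_sigma_preimage coors A -> g_sigma_preimage coors (~` A).
Proof. exact: sigma_algebraC. Qed.

Let rV_bigcup (F : (set _)^nat) : (forall i, g_sigma_preimage coors (F i)) ->
  g_sigma_preimage coors (\bigcup_i (F i)).
Proof. exact: sigma_algebra_bigcup. Qed.

HB.instance Definition _ := @isMeasurable.Build (measure_rV_display d)
  'rV[T]_n (g_sigma_preimage coors) rV_set0 rV_setC rV_bigcup.

End measurable_rV.

Lemma measurable_coord d (T : sigmaRingType d) n (i : 'I_n) :
  measurable_fun [set: 'rV[T]_n] (fun x : 'rV[T]_n => x ord0 i).
Proof.
move=> _ Y mY; rewrite setTI; apply: sub_sigma_algebra => /=.
rewrite -bigcup_seq/=; exists i => /=; first by rewrite mem_index_enum.
by exists Y => //; rewrite setTI.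
Qed.

Lemma measurable_fun_coordP d1 d2 (T1 : measurableType d1)
    (T2 : measurableType d2) n (f : T1 -> 'rV[T2]_n) :
  measurable_fun [set: T1] f <->
  forall i, measurable_fun [set: T1] (fun x => f x ord0 i).
Proof.
split=> [mf i|mf].
  by apply: (measurableT_comp (measurable_coord i) mf).
move=> _ A mA; rewrite setTI.
have : (g_sigma_preimage (fun i x => f x ord0 i)) (f @^-1` A).
  rewrite (@g_sigma_preimage_comp _ T2 n 'rV[T2]_n (fun i x => x ord0 i) _ f).
  by exists A => //; rewrite setTI.
apply: smallest_sub; first exact: sigma_algebra_measurable.
rewrite -bigcup_seq/= => B [i _ [C mC <-]].
exact: mf.
Qed.

(* Lebesgue measure on R^n, as an iterated product of the one on R. *)

Section rV_cons.
Context {d : measure_display} {T : measurableType d}.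
Variable n : nat.

Definition rV_cons (p : T * 'rV[T]_n) : 'rV[T]_n.+1 :=
  \row_(i < n.+1) if unlift ord0 i is Some j then p.2 ord0 j else p.1.

Definition rV_uncons (x : 'rV[T]_n.+1) : T * 'rV[T]_n :=
  (x ord0 ord0, \row_(j < n) x ord0 (lift ord0 j)).

Lemma rV_consK : cancel rV_cons rV_uncons.
Proof.
move=> [a v]; rewrite /rV_cons /rV_uncons; congr pair.
  by rewrite mxE unlift_none.
by apply/rowP => j; rewrite !mxE liftK.
Qed.

Lemma rV_unconsK : cancel rV_uncons rV_cons.
Proof.
move=> x; apply/rowP => i; rewrite mxE.
by case: unliftP => [j ->|->] /=; rewrite ?mxE.
Qed.

Lemma measurable_rV_cons : measurable_fun [set: T * 'rV[T]_n] rV_cons.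
Proof.
apply/measurable_fun_coordP => i.
under eq_fun do rewrite mxE.
case: unliftP => [j _|_]; last exact: measurable_fst.
exact: (measurableT_comp (measurable_coord j) measurable_snd).
Qed.

Lemma measurable_rV_uncons : measurable_fun [set: 'rV[T]_n.+1] rV_uncons.
Proof.
apply/measurable_fun_pair; first exact: measurable_coord.
apply/measurable_fun_coordP => j.
by under eq_fun do rewrite mxE; exact: measurable_coord.
Qed.

End rV_cons.

Section lebesgue_step.
Local Open Scope ereal_scope.
Context {R : realType} {n : nat}.
Variable mu : {sigma_finite_measure set 'rV[R]_n -> \bar R}.

Definition lebesgue_step : set 'rV[R]_n.+1 -> \bar R :=
  pushforward (@lebesgue_measure R \x mu) (@rV_cons _ R n).

Let nu : {measure set 'rV[R]_n.+1 -> \bar R} :=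
  measure_function_pushforward__canonical__measure_function_Measure
    (@lebesgue_measure R \x mu) (@measurable_rV_cons _ R n).

Let lebesgue_step0 : lebesgue_step set0 = 0.
Proof. exact: (measure0 nu). Qed.

Let lebesgue_step_ge0 A : 0 <= lebesgue_step A.
Proof. exact: (measure_ge0 nu). Qed.

Let lebesgue_step_sigma_additive : semi_sigma_additive lebesgue_step.
Proof. exact: (@measure_semi_sigma_additive _ _ _ nu). Qed.

HB.instance Definition _ := isMeasure.Build _ _ _ lebesgue_step
  lebesgue_step0 lebesgue_step_ge0 lebesgue_step_sigma_additive.

Let lebesgue_step_sigma_finite : sigma_finite setT lebesgue_step.
Proof.
have /sigma_finiteP[F [TF ndF Foo]] := sigma_finiteT (@lebesgue_measure R).
have /sigma_finiteP[G [TG ndG Goo]] := sigma_finiteT mu.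
exists (fun k => @rV_uncons _ R n @^-1` (F k `*` G k)).
  rewrite -preimage_bigcup (_ : \bigcup_k _ = setT) ?preimage_setT//.
  rewrite -setXTT TF TG predeqE => -[x y]; split.
    by move=> [k _ []/= ? ?]; split; exists k.
  move=> [/= [i _ Fix_] [k _ Gky]]; exists (maxn i k) => //; split.
  - by move: x Fix_; exact/subsetPset/ndF/leq_maxl.
  - by move: y Gky; exact/subsetPset/ndG/leq_maxr.
move=> k; have [mF Fk] := Foo k; have [mG Gk] := Goo k; split.
  rewrite -[X in measurable X]setTI; apply: measurable_rV_uncons => //.
  exact: measurableX.
rewrite /lebesgue_step /pushforward -comp_preimage.
rewrite (_ : _ \o _ = id); last by apply/funext => x /=; rewrite rV_consK.
by rewrite preimage_id product_measure1E// lte_mul_pinfty// ge0_fin_numE.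
Qed.

HB.instance Definition _ := Measure_isSigmaFinite.Build _ _ _ lebesgue_step
  lebesgue_step_sigma_finite.

End lebesgue_step.

Fixpoint lebesgue_rV (R : realType) (n : nat) :
    {sigma_finite_measure set 'rV[R]_n -> \bar R} :=
  if n is m.+1 then lebesgue_step (lebesgue_rV R m) else \d_(0 : 'rV[R]_0).

Lemma lebesgue_rV_box (R : realType) n (A : 'I_n -> set R) :
  (forall i, measurable (A i)) ->
  lebesgue_rV R n [set x : 'rV[R]_n | forall i, A i (x ord0 i)] =
  (\prod_(i < n) @lebesgue_measure R (A i))%E.
Proof.
elim: n A => [|n IH] A mA /=.
  rewrite big_ord0 diracE mem_set//= => -[]; by [].
rewrite big_ord_recl -(IH (fun i => A (lift ord0 i)))//.
rewrite /lebesgue_step /pushforward -product_measure1E; last 2 first.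
- exact: mA.
- rewrite (_ : [set _ | _] = \bigcap_(i in [set: 'I_n])
      ((fun x : 'rV[R]_n => x ord0 i) @^-1` A (lift ord0 i))).
    apply: fin_bigcap_measurable => // i _.
    by rewrite -[X in measurable X]setTI; apply: measurable_coord.
  by apply/seteqP; split => x /= h i; [move=> _; exact: h|exact: h].
congr (product_measure1 _ _ _); apply/seteqP; split => -[a v] /=.
  move=> h; split=> [|i]; first by have := h ord0; rewrite mxE unlift_none.
  by have := h (lift ord0 i); rewrite mxE liftK.
move=> [Aa Av] i; rewrite mxE.
by case: unliftP => [j ->|->].
Qed.

Section sobolev.
Context {R : realType} {d : nat}.
Local Notation space := 'rV[R]_d.
Local Notation mu := (lebesgue_rV R d).

Definition partial (i : 'I_d) (f : space -> R) : space -> R :=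
  fun x => 'D_(delta_mx ord0 i) f x.

Definition gradient (f : space -> R) (x : space) : 'rV[R]_d :=
  \row_i partial i f x.

Definition dot (a b : 'rV[R]_d) : R := \sum_(i < d) a ord0 i * b ord0 i.

(* C^oo: all iterated partial derivatives are differentiable everywhere. *)
Definition smooth (f : space -> R) : Prop :=
  forall (s : seq 'I_d) (x : space), differentiable (foldr partial f s) x.

(* C_c^oo(Omega), its elements being extended by 0 to the whole space. *)
Definition test_function (Omega : set space) (phi : space -> R) : Prop :=
  smooth phi /\
  exists K : set space, [/\ compact K, K `<=` Omega &
                          forall x, ~ K x -> phi x = 0].

(* Near each boundary point, Omega is the strict sublevel set {rho < 0} of a
   smooth function rho whose gradient does not vanish at that point. *)
Definition smooth_boundary (Omega : set space) : Prop :=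
  forall p : space, (closure Omega `\` interior Omega) p ->
    exists rho : space -> R,
      [/\ smooth rho, gradient rho p != 0 &
          \forall x \near p, Omega x <-> rho x < 0].

Record smooth_bounded_domain (Omega : set space) : Prop := {
  domain_nonempty : Omega !=set0;
  domain_open : open Omega;
  domain_connected : connected Omega;
  domain_bounded : bounded_set Omega;
  domain_smooth : smooth_boundary Omega
}.

Definition square_integrable (Omega : set space) (f : space -> R) : Prop :=
  measurable_fun Omega f /\
  (\int[mu]_(x in Omega) ((f x) ^+ 2)%:E < +oo)%E.

Section H1.
Variable Omega : set space.

(* A representative of an element of H^1(Omega) together with a representative
   of its weak gradient; the values outside Omega are irrelevant. *)
Record H1 := {
  H1_fun :> space -> R;
  wgrad : space -> 'rV[R]_d;
  H1_L2 : square_integrable Omega H1_fun;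
  wgrad_L2 : forall i : 'I_d,
    square_integrable Omega (fun x => wgrad x ord0 i);
  wgrad_weak : forall (phi : space -> R) (i : 'I_d),
    test_function Omega phi ->
    (\int[mu]_(x in Omega) (H1_fun x * partial i phi x)%:E =
     - \int[mu]_(x in Omega) (wgrad x ord0 i * phi x)%:E)%E
}.

(* H_0^1(Omega): the closure of C_c^oo(Omega) in the H^1(Omega) norm. *)
Definition H10 (u : H1) : Prop :=
  forall eps : R, 0 < eps -> exists2 phi : space -> R,
    test_function Omega phi &
    (\int[mu]_(x in Omega)
       ((u x - phi x) ^+ 2
        + dot (wgrad u x - gradient phi x) (wgrad u x - gradient phi x))%:E
     < eps%:E)%E.

Definition energy (kappa : R) (u : H1) : \bar R :=
  (\int[mu]_(x in Omega)
     (kappa ^+ 2 / 2 * dot (wgrad u x) (wgrad u x)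
      + 4^-1 * (1 - u x ^+ 2) ^+ 2)%:E)%E.

End H1.

End sobolev.

(* Backward Euler convolution quadrature. *)

Definition cq_weight {R : realType} (alpha : R) (j : nat) : R :=
  (-1) ^+ j * (\prod_(i < j) (alpha - i%:R)) / (j`!)%:R.

Definition cq_deriv {R : realType} {X : Type} (alpha tau : R)
    (u : nat -> X -> R) (n : nat) (x : X) : R :=
  tau `^ (- alpha) *
  \sum_(1 <= j < n.+1) cq_weight alpha (n - j) * (u j x - u 0%N x).

(* u_n in H_0^1(Omega) is a weak solution of the n-th step of the scheme: the
   equation is tested against all of H_0^1(Omega). The integrals are
   extended-real valued; both terms on the left are finite since u_j, v are in
   H^1(Omega), hence so is the one on the right. *)
Definition CS_step {R : realType} {d : nat} (Omega : set 'rV[R]_d)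
    (alpha kappa tau : R) (u : nat -> H1 Omega) (n : nat) : Prop :=
  H10 (u n) /\
  forall v : H1 Omega, H10 v ->
    (\int[lebesgue_rV R d]_(x in Omega)
        (cq_deriv alpha tau u n x * v x)%:E
     + (kappa ^+ 2)%:E *
       \int[lebesgue_rV R d]_(x in Omega) (dot (wgrad (u n) x) (wgrad v x))%:E
     = \int[lebesgue_rV R d]_(x in Omega)
         ((u n.-1 x - u n x ^+ 3) * v x)%:E)%E.

(* Main.v *)
(* Test step k with u_k and with u_(k-1) and subtract. Pointwise, convexity
   bounds the increment of the energy density from u_(k-1) to u_k by the
   integrand of this difference (whose integral is 0), minus
   (D u)_k (u_k - u_(k-1)), where D is the convolution quadrature. The sum over
   k of these products is nonnegative pointwise: with b_k the partial sums of
   the weights w,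
     (D u)_k ~ b_k (u_k - u_0) + sum_(j < k) (- w_(k-j)) (u_k - u_j),
   and since the b_k are nonnegative and nonincreasing, and so are the -w_j for
   j >= 1, 2 (D u)_k (u_k - u_(k-1)) dominates the increment of
     b_k (u_k - u_0)^2 + sum_(j < k) (- w_(k-j)) (u_k - u_j)^2 >= 0. *)

Require Import Defs.
From mathcomp Require Import all_boot all_order all_algebra.
From mathcomp Require Import all_classical all_reals all_analysis.
From mathcomp Require Import measurable_realfun ring lra.

Set Implicit Arguments.
Unset Strict Implicit.
Unset Printing Implicit Defensive.

Import Order.TTheory GRing.Theory Num.Theory.
Import numFieldNormedType.Exports.

Local Open Scope classical_set_scope.
Local Open Scope ring_scope.

(** * Positivity of the convolution quadrature paired with increments *)

Section cq_positivity.
Context {R : realType}.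
Variable alpha : R.
Hypothesis alpha01 : 0 < alpha < 1.
Local Notation w := (cq_weight alpha).

Lemma cq_weight0 : w 0 = 1.
Proof. by rewrite /cq_weight big_ord0 expr0 fact0 !mulr1 divr1. Qed.

Lemma cq_weightS j : j.+1%:R * w j.+1 = (j%:R - alpha) * w j.
Proof.
have j0 : j.+1%:R != 0 :> R by rewrite pnatr_eq0.
have fj0 : (j`!)%:R != 0 :> R by rewrite pnatr_eq0 -lt0n fact_gt0.
rewrite /cq_weight big_ord_recr /= factS natrM exprS.
rewrite -natr1 in j0 *; by field; rewrite fj0 j0.
Qed.

Lemma cq_weight_le0 j : w j.+1 <= 0.
Proof.
case/andP: alpha01 => a0 a1; elim: j => [|j IH].
  have := cq_weightS 0; rewrite cq_weight0; lra.
have := cq_weightS j.+1.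
have j1 : 1 <= j.+1%:R :> R by rewrite ler1n.
rewrite -[j.+2%:R]natr1; nra.
Qed.

(** The recurrence multiplies a nonpositive weight by [(j + 1 - alpha) / (j + 2)], which lies
    between 0 and 1. *)
Lemma cq_weight_nondecr j : w j.+1 <= w j.+2.
Proof.
case/andP: alpha01 => a0 a1.
have := cq_weightS j.+1; have := cq_weight_le0 j.
have j1 : 1 <= j.+1%:R :> R by rewrite ler1n.
rewrite -[j.+2%:R]natr1; nra.
Qed.

Definition cq_weight_sum k : R := \sum_(j < k.+1) w (k - j).
Local Notation b := cq_weight_sum.

Lemma cq_weight_sumS k : b k.+1 = w k.+1 + b k.
Proof. by rewrite /b big_ord_recl subn0; congr (_ + _). Qed.

(** The weights have generating function (1 - z)^alpha and their partial sums (1 - z)^(alpha - 1);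
    this compares coefficients in the derivative of the former. It carries the sign of [w k.+1] over
    to [b k]. *)
Lemma cq_weight_sumE k : k.+1%:R * w k.+1 = - alpha * b k.
Proof.
elim: k => [|k IH].
  by rewrite cq_weightS /b big_ord_recl big_ord0 cq_weight0; ring.
rewrite cq_weightS cq_weight_sumS mulrDr -IH; ring.
Qed.

Lemma cq_weight_sum_ge0 k : 0 <= b k.
Proof.
case/andP: alpha01 => a0 _; rewrite -(pmulr_rge0 _ a0) -oppr_le0 -mulNr.
by rewrite -cq_weight_sumE mulr_ge0_le0 ?cq_weight_le0.
Qed.

Variable u : nat -> R.

Definition cq_sum k : R := \sum_(1 <= j < k.+1) w (k - j) * (u j - u 0%N).

Lemma cq_sumE k :
  cq_sum k = b k * (u k - u 0%N) + \sum_(j < k) - w (k - j) * (u k - u j).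
Proof.
(* The term [j = 0] can be added because it contains [u 0 - u 0]; then each [u j - u 0] is split as
   [(u k - u 0) - (u k - u j)]. *)
transitivity (\sum_(j < k.+1) w (k - j) * (u j - u 0%N)).
  by rewrite -(big_mkord xpredT (fun j => w (k - j) * (u j - u 0%N)))
    big_ltn// subrr mulr0 add0r.
rewrite /b mulr_suml; apply/eqP; rewrite addrC -subr_eq -sumrB; apply/eqP.
rewrite big_ord_recr /= subrr addr0; apply: eq_bigr => j _; ring.
Qed.

Definition cq_potential k : R :=
  b k * (u k - u 0%N) ^+ 2 + \sum_(j < k) - w (k - j) * (u k - u j) ^+ 2.

Lemma cq_potential_ge0 k : 0 <= cq_potential k.
Proof.
apply: addr_ge0; first by rewrite mulr_ge0 ?sqr_ge0 ?cq_weight_sum_ge0.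
apply: sumr_ge0 => j _; rewrite mulr_ge0 ?sqr_ge0// oppr_ge0.
by rewrite -subnSK// cq_weight_le0.
Qed.

Lemma cq_potential_incr k :
  cq_potential k.+1 - cq_potential k <= 2 * (cq_sum k.+1 * (u k.+1 - u k)).
Proof.
have sq a : (u k.+1 - a) ^+ 2 - (u k - a) ^+ 2 <=
    2 * ((u k.+1 - a) * (u k.+1 - u k)).
  by rewrite -subr_ge0 (_ : _ - _ = (u k.+1 - u k) ^+ 2) ?sqr_ge0//; ring.
rewrite cq_sumE (mulrDl (b k.+1 * _)) (mulrDr 2) /cq_potential opprD addrACA.
apply: lerD.
  (* As [b k.+1 <= b k], replacing [b k] by [b k.+1] in the subtracted square only increases the
     difference. *)
  apply: (@le_trans _ _
    (b k.+1 * ((u k.+1 - u 0%N) ^+ 2 - (u k - u 0%N) ^+ 2))).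
    rewrite mulrBr lerB// ler_wpM2r ?sqr_ge0// cq_weight_sumS gerDr.
    exact: cq_weight_le0.
  by rewrite -mulrA mulrCA ler_wpM2l ?cq_weight_sum_ge0.
rewrite mulr_suml mulr_sumr.
apply: (@le_trans _ _ (\sum_(j < k.+1)
    - w (k.+1 - j) * ((u k.+1 - u j) ^+ 2 - (u k - u j) ^+ 2))).
  under [leRHS]eq_bigr do rewrite mulrBr.
  (* The weights are monotone only from index 1 on, as [w 0 = 1]. The term [j = k], which would
     involve [w 0], vanishes because [u k - u k = 0]. *)
  rewrite sumrB lerB// big_ord_recr /= subrr expr0n mulr0 addr0.
  apply: ler_sum => j _; rewrite ler_wpM2r ?sqr_ge0// lerN2.
  by rewrite subSn 1?ltnW// -subnSK// cq_weight_nondecr.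
apply: ler_sum => j _; rewrite -mulrA mulrCA ler_wpM2l//.
by rewrite oppr_ge0 subSn ?cq_weight_le0// -ltnS.
Qed.

Lemma cq_sum_positive n : 0 <= \sum_(k < n) cq_sum k.+1 * (u k.+1 - u k).
Proof.
suff : cq_potential n <= 2 * \sum_(k < n) cq_sum k.+1 * (u k.+1 - u k).
  by have := cq_potential_ge0 n; lra.
elim: n => [|n IH].
  by rewrite /cq_potential !big_ord0 subrr; lra.
by rewrite big_ord_recr /=; have := cq_potential_incr n; lra.
Qed.

End cq_positivity.

(** * Pointwise convexity inequalities *)

(** The double well is the convex [(x ^+ 4 + 1) / 4] minus the convex [x ^+ 2 / 2]: the tangent of
    the first is taken at the new value [x], that of the second at the old value [y]. *)
Lemma double_well_split {R : realType} (x y : R) :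
  4^-1 * (1 - x ^+ 2) ^+ 2 - 4^-1 * (1 - y ^+ 2) ^+ 2 <=
  (x ^+ 3 - y) * (x - y).
Proof.
rewrite -subr_ge0 (_ : _ - _ = 4^-1 * (x - y) ^+ 2 *
  (2 * x ^+ 2 + (x + y) ^+ 2 + 2)); last by field.
apply: mulr_ge0; first by rewrite mulr_ge0 ?sqr_ge0 ?invr_ge0.
have := sqr_ge0 x; have := sqr_ge0 (x + y); lra.
Qed.

Lemma dot_split {R : realType} d (a c : 'rV[R]_d) :
  2^-1 * dot a a - 2^-1 * dot c c <= dot a a - dot a c.
Proof.
rewrite /dot !mulr_sumr -!sumrB; apply: ler_sum => i _.
by have := sqr_ge0 (a ord0 i - c ord0 i); rewrite !expr2; lra.
Qed.

(** * Measurability of open sets and integrability criteria *)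

(** The sigma-algebra is generated by coordinates, so an open set is written as the countable union
    of the rational boxes it contains. *)
Lemma open_measurable_rV {R : realType} n (U : set 'rV[R]_n) :
  open U -> measurable U.
Proof.
pose box (p : 'rV[rat]_n * 'rV[rat]_n) : set 'rV[R]_n := \bigcap_(i in setT)
  ((fun x : 'rV[R]_n => x ord0 i) @^-1`
     `](ratr (p.1 ord0 i) : R), (ratr (p.2 ord0 i) : R)[%classic).
have mbox p : measurable (box p).
  apply: fin_bigcap_measurable => // i _.
  rewrite -[X in measurable X]setTI; apply: measurable_coord => //.
move=> oU.
rewrite (_ : U = \bigcup_p [set x | box p x /\ box p `<=` U]).
  apply: countable_bigcupT_measurable => // p.
  have [pU|pU] := pselect (box p `<=` U).
    by rewrite (_ : [set x | _] = box p)//; apply/seteqP; split => x // -[].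
  by rewrite (_ : [set x | _] = set0)//; apply/seteqP; split => x // -[].
apply/seteqP; split => [x Ux|x [p _ [px]]]; last exact.
move: oU; rewrite openE => /(_ _ Ux)/nbhs_ballP[e /= e0 xeU].
(* Rational corners closer than [e] to [x] in each coordinate keep the box inside the sup-norm
   ball. *)
have /choice[a xa] : forall i, exists q : rat, x ord0 i - e < ratr q < x ord0 i.
  move=> i; have /rat_in_itvoo[q] : x ord0 i - e < x ord0 i by lra.
  by rewrite in_itv /=; exists q.
have /choice[c xc] : forall i, exists q : rat, x ord0 i < ratr q < x ord0 i + e.
  move=> i; have /rat_in_itvoo[q] : x ord0 i < x ord0 i + e by lra.
  by rewrite in_itv /=; exists q.
exists (\row_i a i, \row_i c i) => //; split => [i _ /=|y bxy].
  by rewrite in_itv /= !mxE; move: (xa i) (xc i) => /andP[_ ->] /andP[-> _].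
apply: xeU; split => // i j; rewrite ord1; move: (bxy j I) (xa j) (xc j).
rewrite /= in_itv /= !mxE => /andP[ay yc] /andP[ea _] /andP[_ ce].
by rewrite -ball_normE /= ltr_norml; lra.
Qed.

Section integrability.
Context d (T : measurableType d) (R : realType).
Variables (mu : {measure set T -> \bar R}) (D : set T).
Hypothesis mD : measurable D.

(** The integral is the difference of those of the positive and negative parts, and is finite only
    if both are. *)
Lemma integral_fin_num_integrable (f : T -> \bar R) : measurable_fun D f ->
  (\int[mu]_(x in D) f x)%E \is a fin_num -> mu.-integrable D f.
Proof.
move=> mf; rewrite integralE fin_numD fin_numN => /andP[fp fn].
apply/integrableP; split => //.
rewrite (_ : integral _ _ _ =
    \int[mu]_(x in D) (f^\+ x + f^\- x))%E; last first.
  by apply: eq_integral => x _; have := congr1 (fun h => h x) (fune_abse f).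
rewrite ge0_integralD//; last 2 first.
- exact: measurable_funepos.
- exact: measurable_funeneg.
by rewrite lte_add_pinfty// ltey_eq ?fp ?fn.
Qed.

Lemma integrable_mul_sqr (f g : T -> R) :
  measurable_fun D f -> measurable_fun D g ->
  (\int[mu]_(x in D) (f x ^+ 2)%:E < +oo)%E ->
  (\int[mu]_(x in D) (g x ^+ 2)%:E < +oo)%E ->
  mu.-integrable D (fun x => (f x * g x)%:E).
Proof.
have int2 (h : T -> R) : measurable_fun D h ->
    (\int[mu]_(x in D) (h x ^+ 2)%:E < +oo)%E ->
    mu.-integrable D (fun x => (h x ^+ 2)%:E).
  move=> mh hoo; apply/integrableP; split.
    exact/measurable_EFinP/measurable_funX.
  rewrite (eq_integral (fun x => (h x ^+ 2)%:E))// => x _.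
  by rewrite /= ger0_norm ?sqr_ge0.
move=> mf mg foo goo.
apply: le_integrable (integrableD mD (int2 f mf foo) (int2 g mg goo)) => //.
  exact/measurable_EFinP/measurable_funM.
move=> x _; rewrite /= lee_fin [leRHS]ger0_norm ?addr_ge0 ?sqr_ge0//.
rewrite ler_norml.
have := sqr_ge0 (f x - g x); have := sqr_ge0 (f x + g x).
by rewrite !expr2; nra.
Qed.

End integrability.

(** * The tested scheme and the pointwise energy inequality *)

Section convex_splitting.
Context {R : realType} {d : nat}.
Variable Omega : set 'rV[R]_d.
Hypothesis mOmega : measurable Omega.
Variables alpha kappa tau : R.
Local Notation mu := (lebesgue_rV R d).

Lemma measurable_dot (f g : 'rV[R]_d -> 'rV[R]_d) :
  (forall i, measurable_fun Omega (fun x => f x ord0 i)) ->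
  (forall i, measurable_fun Omega (fun x => g x ord0 i)) ->
  measurable_fun Omega (fun x => dot (f x) (g x)).
Proof. by move=> mf mg; apply: measurable_sum => i; apply: measurable_funM. Qed.

Definition energy_density (u : H1 Omega) (x : 'rV[R]_d) : R :=
  kappa ^+ 2 / 2 * dot (wgrad u x) (wgrad u x)
    + 4^-1 * (1 - u x ^+ 2) ^+ 2.

Lemma energy_density_ge0 u x : 0 <= energy_density u x.
Proof.
have dot_ge0 : 0 <= dot (wgrad u x) (wgrad u x).
  by apply: sumr_ge0 => i _; rewrite -expr2 sqr_ge0.
apply: addr_ge0; apply: mulr_ge0; rewrite ?sqr_ge0 ?invr_ge0//.
by rewrite divr_ge0 ?sqr_ge0.
Qed.

Lemma measurable_energy_density u : measurable_fun Omega (energy_density u).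
Proof.
apply: measurable_funD; apply: measurable_funM => //.
  by apply: measurable_dot => i; exact: (wgrad_L2 u i).1.
apply/measurable_funX/measurable_funB => //.
by apply/measurable_funX; exact: (H1_L2 u).1.
Qed.

Lemma integrable_H1_mul (f v : H1 Omega) :
  mu.-integrable Omega (fun x => (f x * v x)%:E).
Proof.
have [[mf foo] [mv voo]] := (H1_L2 f, H1_L2 v).
exact: integrable_mul_sqr.
Qed.

Lemma integrable_wgrad_dot (f v : H1 Omega) :
  mu.-integrable Omega (fun x => (dot (wgrad f x) (wgrad v x))%:E).
Proof.
rewrite /dot; under eq_fun do rewrite -sumEFin.
apply: integrable_sum => // i _.
have [[mf foo] [mv voo]] := (wgrad_L2 f i, wgrad_L2 v i).
exact: (@integrable_mul_sqr _ _ _ mu _ mOmega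
  (fun x => wgrad f x ord0 i) (fun x => wgrad v x ord0 i)).
Qed.

Variable u : nat -> H1 Omega.

Lemma integrable_cq_deriv_mul n (v : H1 Omega) :
  mu.-integrable Omega (fun x => (cq_deriv alpha tau u n x * v x)%:E).
Proof.
rewrite (_ : (fun x => _) = (fun x => (tau `^ (- alpha))%:E *
    \sum_(1 <= j < n.+1) (cq_weight alpha (n - j))%:E *
      ((u j x * v x)%:E - (u 0%N x * v x)%:E))%E).
  apply: integrableZl => //; apply: integrable_sum => // j _.
  apply: integrableZl => //; apply: integrableB => //; exact: integrable_H1_mul.
apply/funext => x; rewrite /cq_deriv -mulrA EFinM mulr_suml -sumEFin.
by congr (_ * _)%E; apply: eq_bigr => j _; rewrite -EFinB -EFinM -mulrA mulrBl.
Qed.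

(** Collecting the weak equation into one integrand allows two test functions to be compared
    pointwise before integrating. *)
Definition CS_residual n (v : H1 Omega) (x : 'rV[R]_d) : R :=
  cq_deriv alpha tau u n x * v x
    + kappa ^+ 2 * dot (wgrad (u n) x) (wgrad v x)
    - (u n.-1 x - u n x ^+ 3) * v x.

(* The right-hand side of the scheme is a finite extended-real integral, and
   [+oo - +oo] is [-oo], so its integrand is integrable; this replaces the
   Sobolev embedding of H^1 into L^4. *)
Lemma CS_residual_mean0 n v : CS_step alpha kappa tau u n -> H10 v ->
  mu.-integrable Omega (EFin \o CS_residual n v) /\
  (\int[mu]_(x in Omega) (CS_residual n v x)%:E = 0)%E.
Proof.
move=> [_ /(_ v)] + v0 => /(_ v0) eqn.
have iD := integrable_cq_deriv_mul n v.
have iG := integrable_wgrad_dot (u n) v.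
have iKG : mu.-integrable Omega
    (fun x => (kappa ^+ 2 * dot (wgrad (u n) x) (wgrad v x))%:E).
  exact: integrableZl iG.
have iL := integrableD mOmega iD iKG.
have eqL : (\int[mu]_(x in Omega) (cq_deriv alpha tau u n x * v x +
      kappa ^+ 2 * dot (wgrad (u n) x) (wgrad v x))%:E =
    \int[mu]_(x in Omega) ((u n.-1 x - u n x ^+ 3) * v x)%:E)%E.
  by rewrite -eqn integralD_EFin//; congr (_ + _)%E; rewrite -integralZl.
have iN : mu.-integrable Omega
    (fun x => ((u n.-1 x - u n x ^+ 3) * v x)%:E).
  apply: integral_fin_num_integrable => //.
    apply/measurable_EFinP; apply: measurable_funM; last exact: (H1_L2 v).1.
    apply: measurable_funB; first exact: (H1_L2 (u n.-1)).1.
    by apply/measurable_funX; exact: (H1_L2 (u n)).1.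
  by rewrite -eqL; exact: integrable_fin_num.
split; first exact: integrableB iL iN.
by rewrite integralB_EFin// eqL subee// integrable_fin_num.
Qed.

Hypothesis alpha01 : 0 < alpha < 1.

Lemma energy_density_le n x :
  energy_density (u n) x <= energy_density (u 0%N) x +
    \sum_(k < n) (CS_residual k.+1 (u k.+1) x - CS_residual k.+1 (u k) x).
Proof.
pose a k := u k x.
have cq_ge0 : 0 <= tau `^ (- alpha) *
    \sum_(k < n) cq_sum alpha a k.+1 * (a k.+1 - a k).
  by rewrite mulr_ge0 ?powR_ge0 ?cq_sum_positive.
(* A single quadrature product has no definite sign, only the full sum does; so the products are
   kept on the left throughout the induction. *)
suff : energy_density (u n) x + tau `^ (- alpha) *
    (\sum_(k < n) cq_sum alpha a k.+1 * (a k.+1 - a k)) <=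
    energy_density (u 0%N) x +
    \sum_(k < n) (CS_residual k.+1 (u k.+1) x - CS_residual k.+1 (u k) x).
  by move: cq_ge0; lra.
elim: n {cq_ge0} => [|n IH]; first by rewrite !big_ord0 mulr0.
rewrite !big_ord_recr /= mulrDr.
have := dot_split (wgrad (u n.+1) x) (wgrad (u n) x).
move=> /(ler_wpM2l (sqr_ge0 kappa)).
have := double_well_split (a n.+1) (a n).
move: IH; rewrite /CS_residual /energy_density /cq_deriv /cq_sum /a /=.
lra.
Qed.

End convex_splitting.

(** * Integration of the pointwise inequality *)

Theorem theorem3p2 (R : realType) (d : nat) (hd : (1 <= d <= 3)%N)
    (Omega : set 'rV[R]_d) (hOmega : smooth_bounded_domain Omega)
    (alpha kappa T : R) (halpha : 0 < alpha < 1) (hkappa : 0 < kappa)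
    (hT : 0 < T) (N : nat) (hN : (0 < N)%N)
    (u : nat -> H1 Omega) (hu0 : H10 (u 0%N))
    (hu : forall n : nat, (1 <= n <= N)%N ->
            CS_step alpha kappa (T / N%:R) u n) :
  forall n : nat, (1 <= n <= N)%N ->
    (energy kappa (u n) <= energy kappa (u 0%N))%E.
Proof.
move=> n /andP[_ nN].
have mO : measurable Omega by apply: open_measurable_rV; exact: domain_open.
have uH10 k : (k <= N)%N -> H10 (u k).
  by case: k => // k kN; have [] := hu k.+1 kN.
(* The energy is extended-real valued. An infinite initial energy makes the bound trivial; a finite
   one makes the initial density integrable. *)
have [e0oo|] := ltP (energy kappa (u 0%N)) +oo%E; last exact: le_trans (leey _).
pose mu := lebesgue_rV R d.
pose res k := CS_residual alpha kappa (T / N%:R) u k.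
have mean0 (k : 'I_n) :
    mu.-integrable Omega
      (EFin \o (fun x => res k.+1 (u k.+1) x - res k.+1 (u k) x)) /\
    (\int[mu]_(x in Omega)
      (res k.+1 (u k.+1) x - res k.+1 (u k) x)%:E = 0)%E.
  have kN : (k < N)%N by exact: leq_trans (ltn_ord k) nN.
  have [i1 e1] := CS_residual_mean0 mO (hu k.+1 kN) (uH10 _ kN).
  have [i2 e2] := CS_residual_mean0 mO (hu k.+1 kN) (uH10 _ (ltnW kN)).
  split; first exact: integrableB i1 i2.
  by rewrite integralB_EFin// e1 e2 sube0.
have ie0 : mu.-integrable Omega (EFin \o energy_density kappa (u 0%N)).
  apply/integrableP; split.
    by apply/measurable_EFinP; exact: measurable_energy_density.
  apply: le_lt_trans e0oo; rewrite le_eqVlt; apply/orP; left; apply/eqP.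
  apply: eq_integral => x _; rewrite /= ger0_norm//; exact: energy_density_ge0.
pose H x := \sum_(k < n) (res k.+1 (u k.+1) x - res k.+1 (u k) x).
have iH : mu.-integrable Omega (EFin \o H).
  rewrite (_ : EFin \o H = (fun x => \sum_(k < n)
      (res k.+1 (u k.+1) x - res k.+1 (u k) x)%:E)%E).
    by apply: integrable_sum => // k _; exact: (mean0 k).1.
  by apply/funext => x; rewrite sumEFin.
have H0 : (\int[mu]_(x in Omega) (H x)%:E = 0)%E.
  under eq_integral do rewrite /H -sumEFin.
  rewrite integral_sum//; last by move=> k; exact: (mean0 k).1.
  by apply: big1 => k _; exact: (mean0 k).2.
apply: (@le_trans _ _
  (\int[mu]_(x in Omega) (energy_density kappa (u 0%N) x + H x)%:E)%E).
  (* Monotonicity for nonnegative integrands does not presuppose that [energy kappa (u n)] is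
     finite. *)
  apply: ge0_le_integral => //.
  - by move=> x _; rewrite lee_fin energy_density_ge0.
  - by apply/measurable_EFinP; exact: measurable_energy_density.
  - exact: measurable_int (integrableD mO ie0 iH).
  - by move=> x _; rewrite lee_fin energy_density_le.
by rewrite integralD_EFin// H0 adde0.
Qed.
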